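(* Let $\mu=N(0,I_2)$ be the joint law of $(X,Y)$ with $X\sim N(0,1)$, $Y=\varepsilon\sim N(0,1)$, $X$ independent of $Y$. For each $n$ let $\delta_n=n^{-2}$, $a_n>0$ with $a_n^2=\delta_n^{2n}$, $\nu_n=N(0,a_n^2)\otimes N(0,1)$ and $$\widehat\mu_n=(1-\delta_n)\mu+\delta_n\nu_n.$$ Let $\widehat\beta^*=\sum_{i=1}^nX_i^*Y_i^*\big/\sum_{i=1}^n(X_i^* )^2$ be computed from $(X_i^*,Y_i^* )$, $i\le n$, i.i.d. from $\widehat\mu_n$, and let $\widehat\beta=\sum_{i=1}^nX_iY_i\big/\sum_{i=1}^nX_i^2$ be computed from $(X_i,Y_i)$, $i\le n$, i.i.d. from $\mu$. Then, as $n\to\infty$: (1) $W_4(\widehat\mu_n,\mu)\to0$; (2) $\operatorname{Var}(\widehat\beta^* )/\operatorname{Var}(\widehat\beta)\to\infty$.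
   Context: $W_4$ is the Wasserstein distance of order four with Euclidean cost. *)

(* Defs.v *)
From HB Require Import structures.
From mathcomp Require Import all_boot all_order all_algebra.
From mathcomp Require Import all_classical all_reals all_analysis.

Set Implicit Arguments.
Unset Strict Implicit.
Unset Printing Implicit Defensive.

Import Order.TTheory GRing.Theory Num.Theory.
Import numFieldNormedType.Exports.

Local Open Scope classical_set_scope.
Local Open Scope ring_scope.

Section mixture.
Local Open Scope ereal_scope.
Context d (T : measurableType d) (R : realType).
Variables (t : {i01 R}) (P Q : probability T R).

Definition mixture : set T -> \bar R :=
  measure_add (mscale ((1 - t%:num)%:nng)%R P) (mscale (t%:num%:nng)%R Q).

HB.instance Definition _ := Measure.on mixture.

Lemma mixtureE (A : set T) :
  mixture A = (1 - t%:num)%R%:E * P A + (t%:num)%R%:E * Q A.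
Proof. by rewrite /mixture measure_addE. Qed.

Let mixture_setT : mixture setT = 1.
Proof.
by rewrite mixtureE !probability_setT !mule1 -EFinD GRing.subrK.
Qed.

HB.instance Definition _ :=
  Measure_isProbability.Build _ _ _ mixture mixture_setT.

End mixture.

(* R^2 with its Borel sigma-algebra; [measurableTypeR R] is the carrier of [R]
   as used by [lebesgue_measure] and [normal_prob]. *)
Notation plane R := (measurableTypeR R * measurableTypeR R)%type.

(* The library norm on [R * R] is the max norm, hence the explicit formula. *)
Definition eucl_dist (R : realType) (z w : R * R) : R :=
  Num.sqrt ((z.1 - w.1) ^+ 2 + (z.2 - w.2) ^+ 2).

Section wasserstein.
Local Open Scope ereal_scope.
Variable R : realType.

Definition coupling (P Q : probability (plane R) R)
    (pi : probability (plane R * plane R)%type R) : Prop :=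
  forall A : set (plane R), measurable A ->
    pi (A `*` setT) = P A /\ pi (setT `*` A) = Q A.

(* Valued in [\bar R]: the transport cost may be infinite. *)
Definition wasserstein (p : R) (P Q : probability (plane R) R) : \bar R :=
  ereal_inf [set (\int[pi]_z ((eucl_dist z.1 z.2) `^ p)%:E) `^ p^-1
            | pi in [set pi | coupling P Q pi]].

End wasserstein.

Section iid.
Local Open Scope ereal_scope.
Context d d' (T : measurableType d) (T' : measurableType d') (R : realType).
Variables (P : probability T R) (n : nat).
Implicit Type Z : 'I_n -> {RV P >-> T'}.

Definition mutually_independent Z : Prop :=
  forall (J : {set 'I_n}) (A : 'I_n -> set T'),
    (forall i, measurable (A i)) ->
    P (\bigcap_(i in [set` J]) (Z i @^-1` A i)) =
    \prod_(i in J) P (Z i @^-1` A i).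

Definition iid (law : probability T' R) Z : Prop :=
  mutually_independent Z /\
  forall i (A : set T'), measurable A -> distribution P (Z i) A = law A.

End iid.

(* The [i]-th observation is the pair [Z i w = (X_i, Y_i)]; the quotient is 0
   on the null event where the denominator vanishes. *)
Definition ols_slope (R : realType) (T : Type) (n : nat)
    (Z : 'I_n -> T -> R * R) (w : T) : R :=
  (\sum_i (Z i w).1 * (Z i w).2) / (\sum_i (Z i w).1 ^+ 2).

(* [normal_prob m s] is parametrized by the standard deviation [s], so this is
   N(0, s1 ^ 2) (x) N(0, s2 ^ 2). *)
Definition normal2 (R : realType) (s1 s2 : R) : probability (plane R) R :=
  (normal_prob 0 s1 \x normal_prob 0 s2)%E.

(* Main.v *)
(** Everything reduces to probabilities of product events, so neither the exact
    variances nor conditioning on the X_i is needed.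

    - W_4: the common part [(1 - delta) mu] stays in place and [delta nu] is
      coupled independently with [delta mu]; the cost is [delta] times a bounded
      fourth moment.
    - Var(beta) is at most polynomial in n: by Cauchy-Schwarz and AM-GM,
      [beta^2 <= ((sum Y^2)^2 + (sum X^2)^-2) / 2], with Y of finite fourth
      moment.  The event
      [(sum X^2)^-2 > 16^k] forces every [|X_i| <= 2^-k], which has probability
      at most [2^(-k n)]; summing over k bounds the expectation when n >= 5.
    - Var(beta-star) is superpolynomial: with probability at least
      [(delta c)^n] all the [X_i] lie in ]0, a] and all the [Y_i] are >= 1, and
      then the slope is >= 1/a; likewise it is <= -1/a when all the [Y_i] are
      <= -1.  Whatever the mean is, one of the two events contributes
      [(delta c)^n / a^2 = (c n^2)^n] to the variance. *)
Require Import Defs.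
From HB Require Import structures.
From mathcomp Require Import all_boot all_order all_algebra.
From mathcomp Require Import all_classical all_reals all_analysis.
From mathcomp Require Import measurable_realfun ring lra.

Set Implicit Arguments.
Unset Strict Implicit.
Unset Printing Implicit Defensive.

Import Order.TTheory GRing.Theory Num.Theory.
Import numFieldNormedType.Exports.

Local Open Scope classical_set_scope.
Local Open Scope ring_scope.

(** * Expectations from tail probabilities *)

Section dyadic_tails.
Context d (T : measurableType d) (R : realType).

(** Induction on [K]: if already [f x <= 16 ^ K], the shorter sum suffices; otherwise the new last
    term [16 ^ (K + 1)] alone dominates [f x]. *)
Lemma le_dyadic_sum (f : T -> R) (x : T) (K : nat) : f x <= 16 ^+ K ->
  f x <= 1 + \sum_(0 <= k < K) 16 ^+ k.+1 * \1_[set y | 16 ^+ k < f y] x.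
Proof.
elim: K => [|K IH]; first by rewrite big_geq// addr0 expr0.
move=> fK; rewrite big_nat_recr//= addrA.
have [fK'|fK'] := leP (f x) (16 ^+ K).
  by rewrite (le_trans (IH fK'))// lerDl mulr_ge0// exprn_ge0.
rewrite indicE mem_set//= mulr1 (le_trans fK)// lerDr addr_ge0// sumr_ge0//.
Qed.

(** Integrating the dyadic bound term by term, the [k]-th term contributes at most [16 ^ (k + 1) * C
    / 32 ^ k = 16 * C / 2 ^ k], and the geometric series sums to [32 * C]. Tails decaying at rate 32
    thus beat the growth 16 of the levels. *)
Lemma integral_le_dyadic (P : probability T R) (f : T -> R) (C : R) :
  measurable_fun setT f -> (forall x, 0 <= f x) -> 0 <= C ->
  (forall k, (P [set x | (16 ^+ k < f x)%R] <= (C / 32 ^+ k)%:E)%E) ->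
  (\int[P]_x (f x)%:E <= (1 + 32 * C)%:E)%E.
Proof.
move=> mf f0 C0 Pf.
pose A k := [set x | 16 ^+ k < f x].
have mA k : measurable (A k).
  have -> : A k = setT `&` f @^-1` `]16 ^+ k, +oo[ by rewrite setTI preimage_itvoy.
  by apply: mf => //; exact: measurable_itv.
pose g k x : \bar R := (16 ^+ k.+1 * \1_(A k) x)%:E.
have mg k : measurable_fun setT (g k).
  by apply/measurable_EFinP/measurable_funM.
have g0 k x : setT x -> (0 <= g k x)%E by rewrite lee_fin mulr_ge0// exprn_ge0.
apply: (@le_trans _ _ (\int[P]_x (1 + \sum_(0 <= k <oo) g k x))%E).
  apply: ge0_le_integral => //.
  - by move=> x _; rewrite lee_fin.
  - exact/measurable_EFinP.
  - apply: emeasurable_funD => //; apply: ge0_emeasurable_sum => // k x Dx _.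
    exact: g0.
  (* At each point a finite partial sum already dominates, since [f x < K <= 16 ^ K]. *)
  move=> x _; pose K := Num.bound (f x).
  have fK : f x <= 16 ^+ K.
    rewrite ltW// (lt_le_trans (archi_boundP (f0 x)))//.
    by rewrite -natrX ler_nat ltnW// ltn_expl.
  apply: (@le_trans _ _ (1 + \sum_(0 <= k < K) g k x)%E).
    by rewrite -[1%E]/(1%:E) sumEFin -EFinD lee_fin le_dyadic_sum.
  by rewrite leeD2l//; apply: nneseries_lim_ge => k _ _; exact: g0.
rewrite ge0_integralD//; last 2 first.
- by move=> x _; apply: nneseries_ge0 => k _ _; exact: g0.
- by apply: ge0_emeasurable_sum => // k x Dx _; exact: g0.
rewrite (integral_cst P measurableT 1%E)/= probability_setT mule1 EFinD leeD2l//.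
rewrite integral_nneseries//.
apply: lime_le.
  by apply: is_cvg_nneseries => k _ _; apply: integral_ge0 => x _; exact: g0.
apply: nearW => K.
apply: (@le_trans _ _ (\sum_(0 <= k < K) (16 * C * (1 / 2) ^+ k)%:E)%E).
  apply: lee_sum => k _; rewrite /g.
  under eq_integral do rewrite EFinM.
  rewrite ge0_integralZl//=; last exact/measurable_EFinP/measurable_indic.
  rewrite integral_indic// setIT.
  apply: (@le_trans _ _ ((16 ^+ k.+1)%:E * (C / 32 ^+ k)%:E)%E).
    by rewrite lee_pmul// ?lee_fin ?exprn_ge0//; exact: Pf.
  rewrite -EFinM lee_fin.
  suff -> : 16 ^+ k.+1 * (C / 32 ^+ k) = 16 * C * (1 / 2) ^+ k :> R by [].
  rewrite exprS (_ : 1 / 2 = 16 / 32 :> R); last by field.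
  by rewrite expr_div_n; ring.
rewrite sumEFin lee_fin.
suff : \sum_(0 <= k < K) 16 * C * (1 / 2) ^+ k = 32 * C * (1 - (1 / 2) ^+ K).
  move=> ->; rewrite -[leRHS]mulr1 ler_wpM2l ?mulr_ge0// gerBl exprn_ge0//.
elim: K => [|K IH]; first by rewrite big_geq// expr0 subrr mulr0.
by rewrite big_nat_recr//= IH exprS; field.
Qed.

End dyadic_tails.

(** * The normal law *)

Section normal_law.
Context (R : realType).
Implicit Types (s : R) (A : set (measurableTypeR R)).

Let measurable_pdf s D : measurable_fun D (EFin \o @normal_pdf R 0 s).
Proof.
by apply: measurable_funTS; apply/measurable_EFinP; exact: measurable_normal_pdf.
Qed.

Lemma normal_prob_le_peak s A : s != 0 -> measurable A ->
  (normal_prob 0 s A <= (normal_peak s)%:E * lebesgue_measure A)%E.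
Proof.
move=> s0 mA; rewrite -(integral_cst _ mA).
apply: ge0_le_integral => //.
- by move=> x _; rewrite lee_fin normal_pdf_ge0.
- exact: measurable_pdf.
- by move=> x _; rewrite lee_fin normal_pdf_ub.
Qed.

Lemma normal_peak1_le : normal_peak (1 : R) <= 1 / 2.
Proof.
rewrite /normal_peak expr1n mul1r div1r lef_pV2 ?posrE//; last first.
  by rewrite sqrtr_gt0 mulrn_wgt0// pi_gt0.
rewrite -(@ler_pXn2r _ 2)// ?nnegrE ?sqrtr_ge0// sqr_sqrtr; last first.
  by rewrite mulrn_wge0// pi_ge0.
have := @pi_ge2 R; rewrite -mulr_natr expr2; lra.
Qed.

(** The density is at most [1 / 2] and the interval has length [2 * e]. *)
Lemma std_normal_small_ball (e : R) : 0 <= e ->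
  (normal_prob 0 1 ([set` `[- e, e]%R] : set (measurableTypeR R)) <= e%:E)%E.
Proof.
move=> e0; apply: le_trans (normal_prob_le_peak _ _) _ => //.
have -> : lebesgue_measure ([set` `[- e, e]%R] : set (measurableTypeR R)) = (2 * e)%:E.
  rewrite lebesgue_measure_itv/= lte_fin; case: ifPn => [_|].
    by rewrite -EFinB opprK mulr2n mulrDl mul1r.
  rewrite -leNgt => e1; congr EFin; lra.
rewrite -EFinM lee_fin -[leRHS](_ : 1 / 2 * (2 * e) = e); last by field.
by rewrite ler_wpM2r ?mulr_ge0// normal_peak1_le.
Qed.

(* On this set the density at scale [s] is at most [2 * exp (- v)] times the
   one at scale [2 * s], where [v = 4 ^ k / 4]; and [exp (- v) <= 6 / v ^ 3]
   gives the constant [768 = 2 * 6 * 4 ^ 3]. *)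
Lemma normal_prob_tail4 s k : 0 < s <= 1 ->
  (normal_prob 0 s [set x : measurableTypeR R | (16 ^+ k < x ^+ 4)%R]
    <= (768 / 32 ^+ k)%:E)%E.
Proof.
move=> /andP[s0 s1]; set A := [set _ | _].
have mA : measurable A.
  have -> : A = setT `&` (fun x : R => x ^+ 4) @^-1` `]16 ^+ k, +oo[.
    by rewrite setTI preimage_itvoy.
  by apply: measurable_funX => //; exact: measurable_itv.
have ss0 : 2 * s != 0 by rewrite mulf_neq0// gt_eqF.
have peakE : normal_peak s = 2 * normal_peak (2 * s).
  rewrite /normal_peak.
  have -> : (2 * s) ^+ 2 * pi *+ 2 = 2 ^+ 2 * (s ^+ 2 * pi *+ 2) by ring.
  rewrite sqrtrM ?sqr_ge0// sqrtr_sqr.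
  by rewrite ger0_norm// invfM mulrA divff// mul1r.
have c0 : 0 <= 768 / 32 ^+ k :> R.
  by apply: mulr_ge0; [exact: ler0n|rewrite invr_ge0 exprn_ge0// ler0n].
apply: (@le_trans _ _ ((768 / 32 ^+ k)%:E * normal_prob 0 (2 * s) A)%E); last first.
  rewrite -[leRHS]mule1; apply: lee_wpmul2l; first by rewrite lee_fin.
  exact: probability_le1.
rewrite /normal_prob -ge0_integralZl//; last 2 first.
- exact: measurable_pdf.
- by move=> x _; rewrite lee_fin normal_pdf_ge0.
apply: ge0_le_integral => //.
- by move=> x _; rewrite lee_fin normal_pdf_ge0.
- exact: measurable_pdf.
- by apply: measurable_funeM; exact: measurable_pdf.
move=> x Ax; rewrite -EFinM lee_fin !normal_pdfE ?gt_eqF ?mulr_gt0// peakE.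
have x2 : 4 ^+ k <= x ^+ 2.
  rewrite -(@ler_pXn2r _ 2)// ?nnegrE ?sqr_ge0 ?exprn_ge0//.
  by rewrite -!exprM mulnC exprM -natrX (ltW Ax).
pose v : R := 4 ^+ k / 4.
have expv : expR (- v) <= 384 / 32 ^+ k.
  rewrite expRN -[leRHS]invrK lef_pV2 ?posrE ?expR_gt0 ?invr_gt0 ?divr_gt0 ?exprn_gt0//.
  have v0 : 0 <= v by rewrite divr_ge0// exprn_ge0.
  apply: le_trans (expR_ge1Dxn 2 v0); apply: le_trans (_ : v ^+ 3 / 6 <= _).
    rewrite invf_div /v expr_div_n -exprM mulnC exprM.
    have -> : 4 ^+ 3 = 64 :> R by ring.
    have : 32 ^+ k <= 64 ^+ k :> R.
      by apply: lerXn2r; rewrite ?nnegrE ?ler0n// ler_nat.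
    lra.
  by rewrite (_ : 3`!%:R = 6)// lerDr.
(* The exponents [x ^ 2 / (2 * s ^ 2)] and [x ^ 2 / (8 * s ^ 2)] differ by [3 / 8 * x ^ 2 / s ^ 2],
   which is at least [v] because [s <= 1] and [4 ^ k <= x ^ 2]. *)
have -> : normal_fun 0 s x =
    expR (- (3 / 8 * x ^+ 2 / s ^+ 2)) * normal_fun 0 (2 * s) x.
  by rewrite /normal_fun -expRD subr0; congr expR; field; rewrite gt_eqF.
have : expR (- (3 / 8 * x ^+ 2 / s ^+ 2)) <= expR (- v).
  rewrite ler_expR lerN2 /v ler_pdivlMr ?exprn_gt0//.
  have s2 : s ^+ 2 <= 1 by rewrite exprn_ile1// ltW.
  have : 4 ^+ k / 4 * s ^+ 2 <= 4 ^+ k / 4 by rewrite ler_piMr// divr_ge0// exprn_ge0.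
  have : 0 <= x ^+ 2 by exact: sqr_ge0.
  lra.
move=> /le_trans/(_ expv) le1.
rewrite (_ : 768 / 32 ^+ k = 2 * (384 / 32 ^+ k)); last by field; rewrite expf_neq0.
move: le1; set p := normal_peak _; set f := normal_fun _ _ _.
set w := expR _; set c := 384 / _ => le1.
rewrite (_ : 2 * p * (w * f) = 2 * (p * f) * w); last by ring.
rewrite (_ : 2 * c * (p * f) = 2 * (p * f) * c); last by ring.
by rewrite ler_wpM2l// !mulr_ge0// ?normal_peak_ge0// normal_fun_ge0.
Qed.

(** Here [r] bounds the squared distance to 0 in units of [s ^ 2], so on [A] the density is at least
    its peak times [expR (- (r / 2))], a factor independent of the scale. *)
Lemma normal_prob_ge s (r : R) A : s != 0 -> measurable A ->
  (forall x, A x -> x ^+ 2 <= r * s ^+ 2) ->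
  ((normal_peak s * expR (- (r / 2)))%:E * lebesgue_measure A
    <= normal_prob 0 s A)%E.
Proof.
move=> s0 mA Ar; rewrite -(integral_cst _ mA).
apply: ge0_le_integral => //.
- by move=> x _; rewrite lee_fin mulr_ge0 ?normal_peak_ge0// expR_ge0.
- exact: measurable_pdf.
move=> x /Ar xr; rewrite lee_fin normal_pdfE// ler_wpM2l ?normal_peak_ge0//.
rewrite ler_expR subr0 mulNr lerN2 ler_pdivrMr; last first.
  by rewrite mulrn_wgt0// exprn_even_gt0.
by rewrite (_ : r / 2 * (s ^+ 2 *+ 2) = r * s ^+ 2)//; field.
Qed.

End normal_law.

(** * Product normal laws: marginals, fourth moments and corner events *)

Section normal2_law.
Context (R : realType).
Implicit Types A B : set (measurableTypeR R).

Lemma normal2_setX (s1 s2 : R) A B : measurable A -> measurable B ->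
  (normal2 s1 s2 (A `*` B) = normal_prob 0 s1 A * normal_prob 0 s2 B)%E.
Proof. by move=> mA mB; rewrite /normal2/= product_measure1E. Qed.

Lemma normal2_setXT (s1 s2 : R) A : measurable A ->
  normal2 s1 s2 (A `*` setT) = normal_prob 0 s1 A.
Proof. by move=> mA; rewrite normal2_setX// probability_setT mule1. Qed.

Lemma normal2_setTX (s1 s2 : R) B : measurable B ->
  normal2 s1 s2 (setT `*` B) = normal_prob 0 s2 B.
Proof. by move=> mB; rewrite normal2_setX// probability_setT mul1e. Qed.

(** The tail estimate [normal_prob_tail4] feeds the dyadic bound with [C = 768]. Uniformity in
    [s <= 1] matters, since the scales [a n] vary with [n]. *)
Lemma integral_pow4_le d (T : measurableType d) (P : probability T R)
    (f : T -> measurableTypeR R) (s : R) : 0 < s <= 1 -> measurable_fun setT f ->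
  (forall A, measurable A -> P (f @^-1` A) = normal_prob 0 s A) ->
  (\int[P]_x (f x ^+ 4)%:E <= (1 + 32 * 768)%:E)%E.
Proof.
move=> s01 mf Pf; apply: integral_le_dyadic.
- by apply: measurable_funX.
- by move=> x; rewrite exprn_even_ge0.
- exact: ler0n.
move=> k; apply: le_trans (normal_prob_tail4 k s01).
rewrite -Pf//.
have -> : [set x : measurableTypeR R | 16 ^+ k < x ^+ 4] =
    setT `&` (fun x : R => x ^+ 4) @^-1` `]16 ^+ k, +oo[.
  by rewrite setTI preimage_itvoy.
by apply: measurable_funX => //; exact: measurable_itv.
Qed.

(** The strict bound [0 < x] keeps the denominator of the slope positive for a nonempty sample lying
    in a corner. *)
Definition upper_corner (s : R) : set (plane R) :=
  [set x | 0 < x <= s] `*` [set y | 1 <= y].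

Definition lower_corner (s : R) : set (plane R) :=
  [set x | 0 < x <= s] `*` [set y | y <= -1].

Let measurable_left (s : R) : measurable ([set x | 0 < x <= s] : set (measurableTypeR R)).
Proof. by rewrite -(set_itvoc 0 s); exact: measurable_itv. Qed.

Let measurable_upper : measurable ([set y | 1 <= y] : set (measurableTypeR R)).
Proof. by rewrite -(set_itvcy 1); exact: measurable_itv. Qed.

Let measurable_lower : measurable ([set y | y <= -1] : set (measurableTypeR R)).
Proof. by rewrite -(set_itvNyc (-1)); exact: measurable_itv. Qed.

Lemma measurable_upper_corner (s : R) : measurable (upper_corner s).
Proof. exact: measurableX. Qed.

Lemma measurable_lower_corner (s : R) : measurable (lower_corner s).
Proof. exact: measurableX. Qed.

(** Uniformity in [s] comes from scaling: []0, s]] lies within one standard deviation ([r = 1]),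
    whence [c1]. The half-lines contain the unit intervals [[1, 2]] and [[-2, -1]], on which
    [y ^ 2 <= 4] ([r = 4]), whence [c2]. *)
Lemma normal2_corner_ge : exists2 c : R, 0 < c & forall s : R, 0 < s ->
  (c%:E <= normal2 s 1 (upper_corner s))%E /\
  (c%:E <= normal2 s 1 (lower_corner s))%E.
Proof.
pose c1 : R := normal_peak 1 * expR (- (1 / 2)).
pose c2 : R := normal_peak 1 * expR (- (4 / 2)).
have c10 : 0 < c1 by rewrite mulr_gt0 ?expR_gt0// normal_peak_gt0.
have c20 : 0 < c2 by rewrite mulr_gt0 ?expR_gt0// normal_peak_gt0.
exists (c1 * c2); first exact: mulr_gt0.
move=> s s0.
have left_ge : (c1%:E <= normal_prob 0 s [set x : measurableTypeR R | (0 < x <= s)%R])%E.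
  rewrite -(set_itvoc 0 s).
  apply: le_trans (@normal_prob_ge _ _ 1 _ _ _ _); rewrite ?gt_eqF//.
  - rewrite lebesgue_measure_itv/= lte_fin s0 -EFinB subr0 -EFinM lee_fin.
    (* The length [s] cancels the factor [1 / s] in [normal_peak s], leaving [normal_peak 1]. *)
    rewrite mulrAC ler_wpM2r ?expR_ge0//.
    rewrite /normal_peak expr1n mul1r -mulrnAr sqrtrM ?sqr_ge0// sqrtr_sqr.
    by rewrite gtr0_norm// invfM mulrC mulrA divff ?gt_eqF// mul1r.
  - move=> x; rewrite /= in_itv/= => /andP[x0 xs].
    by rewrite mul1r ler_pXn2r// nnegrE ltW.
have right_ge (D E : set (measurableTypeR R)) b : E = [set` `[b, b + 1]] ->
    measurable D -> E `<=` D -> (forall x, E x -> x ^+ 2 <= 4) ->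
    (c2%:E <= normal_prob 0 1 D)%E.
  move=> Eb mD ED E4.
  have mE : measurable E by rewrite Eb; exact: measurable_itv.
  apply: (@le_trans _ _ (normal_prob 0 1 E)); last by rewrite le_measure// inE.
  apply: le_trans (@normal_prob_ge _ _ 4 _ _ mE _) => //; last first.
    by move=> x /E4; rewrite expr1n mulr1.
  rewrite Eb lebesgue_measure_itv/= lte_fin ltrDl ltr01 -EFinB -EFinM lee_fin.
  by rewrite (addrC b) addrK mulr1.
rewrite !normal2_setX// EFinM; split; apply: lee_pmul => //;
  rewrite ?lee_fin ?(ltW c10) ?(ltW c20)//.
- apply: (right_ge _ [set` `[1, 1 + 1]] 1) => // x /=;
    rewrite in_itv/= => /andP[x1 x2] //.
  nra.
- apply: (right_ge _ [set` `[-2, -2 + 1]] (-2)) => // x /=;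
    rewrite in_itv/= => /andP[x1 x2] //.
  + lra.
  + nra.
Qed.

End normal2_law.

(** * Finite sums *)

Section sums.
Context (R : realFieldType) (n : nat).
Implicit Types x y : 'I_n -> R.

Lemma sum_sqr_eq0 x : \sum_i x i ^+ 2 = 0 -> forall i, x i = 0.
Proof.
move=> /eqP; rewrite psumr_eq0; last by move=> i _; exact: sqr_ge0.
move=> /allP x0 i; apply/eqP; rewrite -sqrf_eq0.
exact: (implyP (x0 i (mem_index_enum _))) isT.
Qed.

(** Cauchy-Schwarz: with [S], [q] the sums of squares and [p] the mixed sum, expanding the
    nonnegative sum of [(p * x i - S * y i) ^ 2] gives [S * (S * q - p ^ 2)], and [S > 0] can be
    divided out. *)
Lemma sqr_sum_mul_le x y :
  (\sum_i x i * y i) ^+ 2 <= (\sum_i x i ^+ 2) * (\sum_i y i ^+ 2).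
Proof.
have [S0|S0] := eqVneq (\sum_i x i ^+ 2) 0.
  rewrite S0 mul0r [X in X ^+ 2]big1 ?expr0n// => i _.
  by rewrite (sum_sqr_eq0 S0) mul0r.
have Sp : 0 < \sum_i x i ^+ 2.
  by rewrite lt_neqAle eq_sym S0 sumr_ge0// => i _; exact: sqr_ge0.
set S := \sum_i x i ^+ 2 in S0 Sp *; set p := \sum_i _; set q := \sum_i _.
have : 0 <= \sum_i (p * x i - S * y i) ^+ 2 by apply: sumr_ge0 => i _; exact: sqr_ge0.
have -> : \sum_i (p * x i - S * y i) ^+ 2 = S * (S * q - p ^+ 2).
  transitivity (\sum_i (p ^+ 2 * x i ^+ 2 - 2 * p * S * (x i * y i) +
      S ^+ 2 * y i ^+ 2)); first by apply: eq_bigr => i _; ring.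
  rewrite big_split/= sumrB -!mulr_sumr -/S -/p -/q; ring.
by rewrite pmulr_rge0// subr_ge0.
Qed.

Lemma sqr_sum_le x : (\sum_i x i) ^+ 2 <= n%:R * \sum_i x i ^+ 2.
Proof.
have := sqr_sum_mul_le (fun=> 1) x.
under eq_bigr do rewrite mul1r.
under [X in _ <= X * _ -> _]eq_bigr do rewrite expr1n.
by rewrite sumr_const card_ord.
Qed.

(** The slope squared is at most [q / S] by Cauchy-Schwarz, then AM-GM separates [q] from [S^-1],
    and a second Cauchy-Schwarz bounds [q ^ 2]. The two resulting terms involve [y] alone and [x]
    alone, so they can be integrated separately. *)
Lemma sqr_slope_le x y : ((\sum_i x i * y i) / \sum_i x i ^+ 2) ^+ 2 <=
  1 / 2 * (n%:R * \sum_i y i ^+ 4 + (\sum_i x i ^+ 2) ^- 2).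
Proof.
have CS := sqr_sum_mul_le x y.
have := sqr_sum_le (fun i => y i ^+ 2).
under [X in _ <= _ * X -> _]eq_bigr do rewrite -exprM.
set S := \sum_i x i ^+ 2 in CS *; set q := \sum_i y i ^+ 2 in CS * => q2.
apply: (@le_trans _ _ (q * S^-1)); last first.
  have : 0 <= (q - S^-1) ^+ 2 by exact: sqr_ge0.
  by rewrite -exprVn; nra.
have S_ge0 : 0 <= S by apply: sumr_ge0 => i _; exact: sqr_ge0.
(* When [S = 0] the convention [0^-1 = 0] makes both sides vanish. *)
have [S0|S0] := eqVneq S 0; first by rewrite S0 invr0 !mulr0 expr0n.
rewrite exprMn exprVn ler_pdivrMr ?exprn_gt0 ?lt_neqAle ?S_ge0 1?eq_sym ?S0//.
by rewrite expr2 mulrA divfK// [q * S]mulrC.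
Qed.

End sums.

(** * The slope of an i.i.d. sample *)

Section iid_sample.
Context d (T : measurableType d) (R : realType).
Variables (P : probability T R) (n : nat) (law : probability (plane R) R).
Variable Z : 'I_n -> {RV P >-> plane R}.
Hypothesis Z_iid : iid law Z.

Lemma measurable_all_in (A : set (plane R)) : measurable A ->
  measurable [set w | forall i, A (Z i w)].
Proof.
move=> mA; have -> : [set w | forall i, A (Z i w)] =
    \bigcap_(i in [set: 'I_n]) (Z i @^-1` A).
  by apply/seteqP; split=> [w Aw i _|w Aw i]; apply: Aw.
apply: fin_bigcap_measurable => // i _.
by rewrite -[X in measurable X]setTI; exact: measurable_funPT.
Qed.

(** Independence is applied to the full index set with one common event. This [n]-th power yields
    both the small-ball decay for the ordinary sample and the lower bound for the contaminated
    one. *)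
Lemma iid_all_in (A : set (plane R)) : measurable A ->
  P [set w | forall i, A (Z i w)] = (fine (law A) ^+ n)%:E.
Proof.
move=> mA; have [indep same] := Z_iid.
have -> : [set w | forall i, A (Z i w)] =
    \bigcap_(i in [set` [set: 'I_n]%SET]) (Z i @^-1` A).
  apply/seteqP; split=> [w Aw i _|w Aw i]; first exact: Aw.
  by apply: Aw; rewrite /= inE.
rewrite (indep [set: 'I_n]%SET (fun=> A))//.
transitivity (\prod_(i in [set: 'I_n]%SET) (fine (law A))%:E)%E.
  apply: eq_bigr => i _; rewrite fineK ?fin_num_measure// -(same i A mA).
  by [].
by rewrite prodEFin prodr_const cardsT card_ord.
Qed.

Lemma measurable_obs1 i : measurable_fun setT (fun w => (Z i w).1 : R).
Proof. exact: (measurableT_comp measurable_fst (measurable_funPT (Z i))). Qed.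

Lemma measurable_obs2 i : measurable_fun setT (fun w => (Z i w).2 : R).
Proof. exact: (measurableT_comp measurable_snd (measurable_funPT (Z i))). Qed.

Lemma measurable_inv_sum_sqr :
  measurable_fun setT (fun w => (\sum_i ((Z i w).1 : R) ^+ 2)^-1).
Proof.
(* On nonnegative reals the inverse agrees with the power [-1], also at 0 where both are 0, so
   measurability of [powR] applies. *)
have -> : (fun w => (\sum_i ((Z i w).1 : R) ^+ 2)^-1) =
    (fun w => (\sum_i ((Z i w).1 : R) ^+ 2) `^ (-1)).
  by apply/funext => w; rewrite powR_inv1// sumr_ge0// => i _; exact: sqr_ge0.
apply: (measurableT_comp (measurable_powR (-1))).
by apply: measurable_sum => i; apply: measurable_funX; exact: measurable_obs1.
Qed.

Lemma measurable_ols_slope : measurable_fun setT (ols_slope Z : T -> R).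
Proof.
apply: measurable_funM; last exact: measurable_inv_sum_sqr.
apply: measurable_sum => i; apply: measurable_funM.
  exact: measurable_obs1.
exact: measurable_obs2.
Qed.

End iid_sample.

(** * Polynomial upper bound on the variance of the slope under the standard normal law *)

Section ols_variance_upper_bound.
Context d (T : measurableType d) (R : realType).
Variables (P : probability T R) (n : nat) (Z : 'I_n -> {RV P >-> plane R}).
Hypothesis Z_iid : iid (normal2 1 1) Z.
Hypothesis n5 : (5 <= n)%N.

Lemma integral_inv_sum_sqr_le :
  (\int[P]_w ((\sum_i ((Z i w).1 : R) ^+ 2) ^- 2)%:E <= (1 + 32 * 1)%:E)%E.
Proof.
apply: integral_le_dyadic => //.
- under eq_fun do rewrite -exprVn.
  by apply: measurable_funX; exact: measurable_inv_sum_sqr.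
- by move=> w; rewrite invr_ge0 exprn_even_ge0.
move=> k; pose e : R := (1 / 2) ^+ k.
have e0 : 0 < e by rewrite exprn_gt0.
pose I : set (measurableTypeR R) := [set` `[- e, e]].
have mI : measurable (I `*` setT : set (plane R)).
  by apply: measurableX => //; exact: measurable_itv.
apply: (@le_trans _ _ (P [set w | forall i, (I `*` setT) (Z i w)])).
  apply: le_measure; rewrite ?inE//.
  - have -> : [set w | 16 ^+ k < (\sum_i ((Z i w).1 : R) ^+ 2) ^- 2] =
        setT `&` (fun w => (\sum_i ((Z i w).1 : R) ^+ 2) ^- 2) @^-1` `]16 ^+ k, +oo[.
      by rewrite setTI preimage_itvoy.
    have : measurable_fun setT (fun w => (\sum_i ((Z i w).1 : R) ^+ 2) ^- 2).
      under eq_fun do rewrite -exprVn.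
      by apply: measurable_funX; exact: measurable_inv_sum_sqr.
    by apply => //; exact: measurable_itv.
  - exact: measurable_all_in.
  move=> w /= wk i; split=> //=.
  set S := \sum_i _ in wk.
  have S0 : 0 <= S by apply: sumr_ge0 => j _; exact: sqr_ge0.
  have XS : (Z i w).1 ^+ 2 <= S.
    by rewrite /S (bigD1 i)//= lerDl sumr_ge0// => j _; exact: sqr_ge0.
  have Se : S <= e ^+ 2.
    rewrite -(@ler_pXn2r _ 2) ?nnegrE ?exprn_ge0 ?(ltW e0)//.
    (* If [S ^ 2] were 0, its inverse would be 0 by convention and could not exceed [16 ^ k]. *)
    have S2 : 0 < S ^+ 2.
      rewrite exprn_even_gt0//=; apply: contraTneq wk => ->.
      by rewrite expr0n invr0 -leNgt exprn_ge0.
    have -> : e ^+ 2 ^+ 2 = (16 ^+ k)^-1.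
      by rewrite /e -!exprM mulnC exprM -exprVn; congr (_ ^+ k); field.
    by rewrite -[leLHS]invrK lef_pV2 ?posrE ?invr_gt0// ?exprn_gt0// ltW.
  rewrite /I /= in_itv/= -ler_norml -(@ler_pXn2r _ 2)// ?nnegrE ?(ltW e0)//.
  by rewrite real_normK ?num_real// (le_trans XS).
rewrite (iid_all_in Z_iid)// lee_fin.
have qe : fine (normal2 1 1 (I `*` setT)) <= e.
  rewrite normal2_setXT; last exact: measurable_itv.
  rewrite -lee_fin fineK ?fin_num_measure//; last exact: measurable_itv.
  exact/std_normal_small_ball/ltW.
apply: (@le_trans _ _ (e ^+ n)).
  by rewrite lerXn2r// nnegrE ?(ltW e0)// fine_ge0.
(* Five observations give [e ^ 5 = 32 ^- k], exactly the tail rate required by the dyadic bound with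
   [C = 1]. *)
apply: (@le_trans _ _ (e ^+ 5)).
  by rewrite ler_wiXn2l// ?(ltW e0)// exprn_ile1//; lra.
rewrite /e -exprM mulnC exprM (_ : (1 / 2) ^+ 5 = 32^-1 :> R); last by field.
by rewrite div1r exprVn.
Qed.

Lemma integral_sum_pow4_le :
  (\int[P]_w (\sum_i ((Z i w).2 : R) ^+ 4)%:E <= (n%:R * (1 + 32 * 768))%:E)%E.
Proof.
under eq_integral do rewrite -sumEFin.
rewrite ge0_integral_sum//; last 2 first.
- move=> i; apply/measurable_EFinP/measurable_funX; exact: measurable_obs2.
- by move=> i w _; rewrite lee_fin exprn_even_ge0.
apply: (@le_trans _ _ (\sum_(i < n) (1 + 32 * 768)%:E)%E).
  apply: lee_sum => i _; apply: (@integral_pow4_le _ _ _ _ _ 1).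
  - by rewrite ltr01 lexx.
  - exact: measurable_obs2.
  move=> A mA; rewrite -(normal2_setTX 1)//.
  rewrite -(Z_iid.2 i); last exact: measurableX.
  rewrite /distribution/= /pushforward; congr (P _).
  by apply/seteqP; split=> [w|w []].
by move: (1 + 32 * 768) => K; rewrite sumEFin sumr_const card_ord mulr_natl.
Qed.

Lemma second_moment_ols_le :
  (\int[P]_w ((ols_slope Z w) ^+ 2)%:E <= (n%:R ^+ 2 * (1 + 32 * 768))%:E)%E.
Proof.
pose F w := \sum_i ((Z i w).2 : R) ^+ 4.
pose G w := (\sum_i ((Z i w).1 : R) ^+ 2) ^- 2.
have mF : measurable_fun setT F.
  by apply: measurable_sum => i; apply: measurable_funX; exact: measurable_obs2.
have mG : measurable_fun setT G.
  rewrite /G; under eq_fun do rewrite -exprVn.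
  by apply: measurable_funX; exact: measurable_inv_sum_sqr.
have F0 w : 0 <= F w by apply: sumr_ge0 => i _; rewrite exprn_even_ge0.
have G0 w : 0 <= G w by rewrite invr_ge0 exprn_even_ge0.
have mnF : measurable_fun setT (fun w => n%:R * F w) by exact: measurable_funM.
apply: (@le_trans _ _ (\int[P]_w (1 / 2 * (n%:R * F w + G w))%:E)%E).
  apply: ge0_le_integral => //.
  - by move=> w _; rewrite lee_fin sqr_ge0.
  - apply/measurable_EFinP/measurable_funX; exact: measurable_ols_slope.
  - by apply/measurable_EFinP/measurable_funM => //; exact: measurable_funD.
  - by move=> w _; rewrite lee_fin; exact: sqr_slope_le.
under eq_integral do rewrite EFinM.
rewrite ge0_integralZl//; last 2 first.
- by apply/measurable_EFinP; exact: measurable_funD.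
- by move=> w _; rewrite lee_fin addr_ge0// mulr_ge0.
under eq_integral do rewrite EFinD.
rewrite ge0_integralD//; last 4 first.
- by move=> w _; rewrite lee_fin mulr_ge0.
- exact/measurable_EFinP.
- by move=> w _; rewrite lee_fin.
- exact/measurable_EFinP.
under eq_integral do rewrite EFinM.
rewrite ge0_integralZl//; last 2 first.
- exact/measurable_EFinP.
- by move=> w _; rewrite lee_fin.
have := integral_inv_sum_sqr_le; have := integral_sum_pow4_le.
have : 1 + 32 * 1 <= 1 + 32 * 768 :> R by lra.
set K := 1 + 32 * 768; set K1 := 1 + 32 * 1 => K1K FK GK.
apply: (@le_trans _ _ ((1 / 2)%:E * (n%:R%:E * (n%:R * K)%:E + K1%:E))%E).
  by rewrite lee_wpmul2l ?lee_fin// leeD// lee_wpmul2l// lee_fin.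
rewrite -[leLHS]/((1 / 2 * (n%:R * (n%:R * K) + K1))%:E) lee_fin.
have n1 : 1 <= n%:R :> R by rewrite ler1n (leq_trans _ n5).
have K0 : 0 <= K by apply: le_trans K1K; rewrite /K1; lra.
(* Since [K1 <= K <= n ^ 2 * K], the half-sum of [n ^ 2 * K] and [K1] is at most [n ^ 2 * K]. *)
have : K <= n%:R * n%:R * K by rewrite ler_peMl// mulr_ege1.
rewrite expr2; lra.
Qed.

(** Square integrability, read off from the finite second-moment bound, licenses writing the
    variance as second moment minus squared mean. *)
Lemma ols_slope_Lfun2 : ols_slope Z \in Lfun P 2%:E.
Proof.
rewrite inE; apply/andP; split; rewrite inE//=.
  exact: measurable_ols_slope.
rewrite /finite_norm unlock /=.
apply: poweR_lty.
apply: le_lt_trans (ltry (n%:R ^+ 2 * (1 + 32 * 768))).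
apply: le_trans second_moment_ols_le.
under eq_integral do rewrite powR_mulrn// real_normK ?num_real//.
exact: lexx.
Qed.

Lemma variance_ols_le :
  ('V_P[ols_slope Z] <= (n%:R ^+ 2 * (1 + 32 * 768))%:E)%E.
Proof.
have B2 := ols_slope_Lfun2.
rewrite varianceE//; apply: le_trans second_moment_ols_le.
have /fineK <- : ('E_P[ols_slope Z])%E \is a fin_num.
  by apply: expectation_fin_num; apply: Lfun_subset12 => //; rewrite fin_num_measure.
apply: (@le_trans _ _ ('E_P[ols_slope Z ^+ 2])%E).
  by rewrite leeBlDr// leeDl// -EFin_expe lee_fin sqr_ge0.
by rewrite unlock.
Qed.

End ols_variance_upper_bound.

(** * Lower bound on the variance of the slope from corner events *)

Section ols_variance_lower_bound.
Context d (T : measurableType d) (R : realType).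
Variables (P : probability T R) (n : nat) (law : probability (plane R) R).
Variable Z : 'I_n -> {RV P >-> plane R}.
Hypothesis Z_iid : iid law Z.

(** Markov's inequality for [f ^ 2], to be used with [f] the slope minus its mean. *)
Lemma integral_sqr_ge (f : T -> R) (B : set T) (c : R) :
  measurable_fun setT f -> measurable B -> 0 <= c ->
  (forall w, B w -> c <= `|f w|) ->
  ((c ^+ 2)%:E * P B <= \int[P]_w (f w ^+ 2)%:E)%E.
Proof.
move=> mf mB c0 fB.
have mf2 : measurable_fun setT (fun w => (f w ^+ 2)%:E).
  exact/measurable_EFinP/measurable_funX.
rewrite -(integral_cst P mB).
apply: (@le_trans _ _ (\int[P]_(w in B) (f w ^+ 2)%:E)%E); last first.
  by apply: ge0_subset_integral => // w _; rewrite lee_fin sqr_ge0.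
apply: ge0_le_integral => //.
- by move=> w _; rewrite lee_fin sqr_ge0.
- exact: measurable_funTS.
move=> w Bw; rewrite lee_fin -[leRHS]real_normK ?num_real//.
by rewrite ler_pXn2r ?nnegrE// fB.
Qed.

(** Termwise, [x <= a <= y * a] gives [x ^ 2 <= x * y * a]; summing and dividing by the positive sum
    of squares gives the bound. *)
Lemma slope_upper_corner (a : R) (z : 'I_n -> R * R) : (0 < n)%N -> 0 < a ->
  (forall i, upper_corner a (z i)) ->
  a^-1 <= (\sum_i (z i).1 * (z i).2) / \sum_i (z i).1 ^+ 2.
Proof.
move=> n0 a0 zU; have {}zU i : [/\ 0 < (z i).1, (z i).1 <= a & 1 <= (z i).2].
  by have [/= /andP[? ?] ?] := zU i.
have Sp : 0 < \sum_i (z i).1 ^+ 2.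
  rewrite (bigD1 (Ordinal n0))//= ltr_pwDl//.
    by rewrite exprn_gt0//; case: (zU (Ordinal n0)).
  by apply: sumr_ge0 => i _; exact: sqr_ge0.
rewrite ler_pdivlMr// mulrC ler_pdivrMr// mulr_suml ler_sum// => i _.
have [x0 xa y1] := zU i.
by rewrite expr2 -mulrA ler_pM2l// (le_trans xa)// ler_peMl// ltW.
Qed.

Lemma variance_ols_ge (a q : R) : (0 < n)%N -> 0 < a -> 0 <= q ->
  (q%:E <= law (upper_corner a))%E -> (q%:E <= law (lower_corner a))%E ->
  ((q ^+ n / a ^+ 2)%:E <= 'V_P[ols_slope Z])%E.
Proof.
move=> n0 a0 q0 qU qL.
rewrite /variance unlock unlock; set m := fine _.
have corner (A : set (plane R)) : measurable A -> (q%:E <= law A)%E ->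
    (forall w, (forall i, A (Z i w)) -> a^-1 <= `|ols_slope Z w - m|) ->
    ((q ^+ n / a ^+ 2)%:E <= \int[P]_w ((ols_slope Z w - m) ^+ 2)%:E)%E.
  move=> mA qA Am.
  apply: le_trans (integral_sqr_ge _ (measurable_all_in Z mA) _ Am); last 2 first.
  - by apply: measurable_funB => //; exact: measurable_ols_slope.
  - by rewrite invr_ge0 ltW.
  rewrite (iid_all_in Z_iid)// -EFinM lee_fin exprVn mulrC.
  rewrite ler_wpM2l ?invr_ge0 ?sqr_ge0// lerXn2r ?nnegrE ?fine_ge0//.
  by rewrite -lee_fin fineK// fin_num_measure.
(* The corner is chosen on the side of 0 away from the mean, so the slope is at distance at least
   [1 / a] from [m]. *)
have [m0|m0] := leP m 0.
  apply: (corner _ (measurable_upper_corner a) qU) => w wU.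
  rewrite (le_trans _ (ler_norm _))// -[leLHS]subr0 lerB//.
  exact: slope_upper_corner.
apply: (corner _ (measurable_lower_corner a) qL) => w wL.
rewrite distrC (le_trans _ (ler_norm _))// -[leLHS]add0r lerD ?(ltW m0)//.
(* Reflecting [Y] to [- Y] carries the lower corner to the upper one and changes the sign of the
   slope. *)
have := @slope_upper_corner a (fun i => ((Z i w).1, - (Z i w).2)) n0 a0.
rewrite /ols_slope -mulNr -sumrN; under [in X in _ -> X]eq_bigr do rewrite -mulrN.
by apply=> i; have [/= ? ?] := wL i; split => //=; rewrite lerNr.
Qed.

End ols_variance_lower_bound.

(** * Superpolynomial growth of the variance ratio *)

Section growth.
Context (R : realType).

(** The first quotient equals [(n ^ 2 * c) ^ n]. Once [n >= c^-1] this is at least [n ^ n], hence at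
    least [n ^ 3] for [n >= 3], and [n >= A * K] absorbs the remaining factor. *)
Lemma near_ratio_ge (c K A : R) : 0 < c -> 0 < K ->
  \forall n \near \oo,
    A <= (n%:R ^- 2 * c) ^+ n / (n%:R ^- 2) ^+ (2 * n) / (n%:R ^+ 2 * K).
Proof.
move=> c0 K0; near=> n.
have n3 : (3 <= n)%N by near: n; exact: nbhs_infty_ge.
have nc : c^-1 <= n%:R by near: n; exact: nbhs_infty_ger.
have nA : A * K <= n%:R by near: n; exact: nbhs_infty_ger.
have n0 : 0 < n%:R :> R by rewrite ltr0n (leq_trans _ n3).
have -> : (n%:R ^- 2 * c) ^+ n / (n%:R ^- 2) ^+ (2 * n) = (n%:R ^+ 2 * c) ^+ n :> R.
  by rewrite exprM -expr_div_n; congr (_ ^+ _); field; rewrite gt_eqF.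
rewrite ler_pdivlMr ?mulr_gt0 ?exprn_gt0//.
apply: (@le_trans _ _ (n%:R ^+ 3)).
  rewrite mulrCA -[leRHS]/(n%:R * (n%:R * n%:R)) [leRHS]mulrC -expr2.
  by rewrite ler_wpM2l// exprn_ge0// ltW.
have n1 : 1 <= n%:R :> R by rewrite ler1n (leq_trans _ n3).
apply: (@le_trans _ _ (n%:R ^+ n)); first by rewrite ler_weXn2l.
rewrite lerXn2r ?nnegrE ?(ltW n0)//.
  by rewrite mulr_ge0 ?sqr_ge0 ?(ltW c0).
rewrite expr2 -mulrA ler_peMr ?(ltW n0)//.
by rewrite -(@ler_pM2r _ c^-1) ?invr_gt0// mul1r mulfK ?gt_eqF.
Unshelve. all: by end_near. Qed.

End growth.

(** * Transport cost *)

Lemma ge0_integral_mixture d (T : measurableType d) (R : realType) (t : {i01 R})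
    (P Q : probability T R) (f : T -> \bar R) :
  measurable_fun setT f -> (forall x, 0 <= f x)%E ->
  (\int[mixture t P Q]_x f x =
    (1 - t%:num)%:E * \int[P]_x f x + t%:num%:E * \int[Q]_x f x)%E.
Proof.
move=> mf f0; rewrite ge0_integral_measure_add//.
by rewrite !ge0_integral_mscale.
Qed.

Section transport.
Context (R : realType).
Implicit Types P Q : probability (plane R) R.

(** The image of a law under this map is its coupling with itself at zero transport cost. *)
Definition diagonal (z : plane R) : plane R * plane R := (z, z).

Let measurable_diagonal : measurable_fun setT diagonal.
Proof. by apply: measurable_fun_pair => //; exact: measurable_id. Qed.

HB.instance Definition _ :=
  isMeasurableFun.Build _ _ _ _ diagonal measurable_diagonal.

(** The diagonal part has marginals [P], [P] and the product part [Q], [P]; mixing them gives the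
    mixture on the left and [(1 - t) P + t P = P] on the right. *)
Lemma coupling_mixture (t : {i01 R}) P Q :
  coupling (mixture t P Q) P
    (mixture t (distribution P (diagonal : {mfun _ >-> _})) (Q \x P)%E).
Proof.
move=> A mA; have mT : measurable [set: plane R] by [].
have QA : (Q \x P)%E (A `*` setT) = Q A.
  by rewrite -[RHS]mule1 -(probability_setT P); exact: product_measure1E.
have PA : (Q \x P)%E (setT `*` A) = P A.
  by rewrite -[RHS]mul1e -(probability_setT Q); exact: product_measure1E.
set D := distribution P _.
have DA1 : D (A `*` setT) = P A.
  by rewrite /D /distribution /pushforward; congr (P _); apply/seteqP; split=> [z []|z].
have DA2 : D (setT `*` A) = P A.
  by rewrite /D /distribution /pushforward; congr (P _); apply/seteqP; split=> [z []|z].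
split.
  apply: (etrans (mixtureE _ _ _ _)); apply/esym; apply: (etrans (mixtureE _ _ _ _)).
  by congr (_ * _ + _ * _)%E; apply/esym; [exact: DA1|exact: QA].
apply: (etrans (mixtureE _ _ _ _)).
transitivity ((1 - t%:num)%:E * P A + t%:num%:E * P A)%E.
  by congr (_ * _ + _ * _)%E; [exact: DA2|exact: PA].
rewrite -ge0_muleDl ?lee_fin ?subr_ge0//.
by rewrite -EFinD subrK mul1e.
Qed.

Lemma eucl_dist_pow4 (z w : R * R) :
  eucl_dist z w `^ 4 = ((z.1 - w.1) ^+ 2 + (z.2 - w.2) ^+ 2) ^+ 2.
Proof.
rewrite /eucl_dist powR_mulrn ?sqrtr_ge0// (exprM _ 2 2) sqr_sqrtr//.
by rewrite addr_ge0// sqr_ge0.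
Qed.

Lemma measurable_cost : measurable_fun setT
  (fun z : plane R * plane R => (eucl_dist z.1 z.2 `^ 4)%:E).
Proof.
under eq_fun do rewrite eucl_dist_pow4.
apply/measurable_EFinP/measurable_funX/measurable_funD; apply: measurable_funX;
  apply: measurable_funB.
- exact: (measurableT_comp measurable_fst measurable_fst).
- exact: (measurableT_comp measurable_fst measurable_snd).
- exact: (measurableT_comp measurable_snd measurable_fst).
- exact: (measurableT_comp measurable_snd measurable_snd).
Qed.

(* The coupling keeps the common mass [1 - t] in place and couples the rest
   independently. *)
Lemma wasserstein_mixture_le (t : {i01 R}) P Q (M : R) :
  (\int[(Q \x P)%E]_z (eucl_dist z.1 z.2 `^ 4)%:E <= M%:E)%E ->
  (wasserstein 4 (mixture t P Q) P <= ((t%:num * M) `^ 4^-1)%:E)%E.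
Proof.
move=> QM; apply: ge_ereal_inf.
set pi := mixture t (distribution P (diagonal : {mfun _ >-> _})) (Q \x P)%E.
exists ((\int[pi]_z (eucl_dist z.1 z.2 `^ 4)%:E) `^ 4^-1)%E.
  by exists pi => //; exact: coupling_mixture.
have c0 (z : plane R * plane R) : (0 <= (eucl_dist z.1 z.2 `^ 4)%:E :> \bar R)%E.
  by rewrite lee_fin powR_ge0.
have t0 : 0 <= t%:num by [].
have M0 : 0 <= M.
  by rewrite -lee_fin (le_trans _ QM)//; apply: integral_ge0 => z _; exact: c0.
rewrite -poweR_EFin; apply: gt0_ler_poweR.
- by rewrite invr_ge0.
- by rewrite in_itv/= leey andbT; apply: integral_ge0 => z _; exact: c0.
- by rewrite in_itv/= leey andbT lee_fin mulr_ge0.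
rewrite (ge0_integral_mixture _ _ _ measurable_cost c0).
rewrite (ge0_integral_distribution _ measurable_cost c0).
under eq_integral do rewrite /= eucl_dist_pow4 !subrr expr0n/= addr0 expr0n/=.
rewrite integral0 mule0 add0e EFinM.
exact: lee_wpmul2l.
Qed.

(** The constant is [2 * 8]: squaring a sum of two terms costs 2, and each [(x - y) ^ 4] is at most
    [8 * (x ^ 4 + y ^ 4)]. *)
Lemma le_cost (z w : R * R) : eucl_dist z w `^ 4 <=
  16 * (z.1 ^+ 4 + z.2 ^+ 4 + (w.1 ^+ 4 + w.2 ^+ 4)).
Proof.
rewrite eucl_dist_pow4 !(exprM _ 2 2).
have le2 (x y : R) : (x - y) ^+ 2 <= 2 * (x ^+ 2 + y ^+ 2).
  by have := sqr_ge0 (x + y); rewrite !expr2; lra.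
have le4 (x y : R) : (x + y) ^+ 2 <= 2 * (x ^+ 2 + y ^+ 2).
  by have := sqr_ge0 (x - y); rewrite !expr2; lra.
apply: (le_trans (le4 _ _)).
have sq (x y : R) : ((x - y) ^+ 2) ^+ 2 <= 8 * ((x ^+ 2) ^+ 2 + (y ^+ 2) ^+ 2).
  apply: (@le_trans _ _ ((2 * (x ^+ 2 + y ^+ 2)) ^+ 2)).
    by rewrite lerXn2r ?nnegrE ?sqr_ge0// mulr_ge0// addr_ge0// sqr_ge0.
  by have := le4 (x ^+ 2) (y ^+ 2); rewrite exprMn; lra.
have := sq z.1 w.1; have := sq z.2 w.2; lra.
Qed.

(** Each of the four coordinates is centred normal with standard deviation [s] or 1, so
    [integral_pow4_le] applies to each term of [le_cost]. The bound is independent of [s]. *)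
Lemma integral_cost_le (s : R) : 0 < s <= 1 ->
  (\int[(normal2 s 1 \x normal2 1 1)%E]_z (eucl_dist z.1 z.2 `^ 4)%:E
    <= (16 * (4 * (1 + 32 * 768)))%:E)%E.
Proof.
move=> s01; set pi := (normal2 s 1 \x normal2 1 1)%E.
have pow4 (r : R) (f : plane R * plane R -> measurableTypeR R) : 0 < r <= 1 ->
    measurable_fun setT f ->
    (forall A, measurable A -> pi (f @^-1` A) = normal_prob 0 r A) ->
    measurable_fun setT (fun z => (f z : R) ^+ 4) /\
    (\int[pi]_z (f z ^+ 4)%:E <= (1 + 32 * 768)%:E)%E.
  move=> r01 mf fA; split; first exact: measurable_funX.
  exact: (integral_pow4_le r01 mf fA).
have mT : measurable [set: plane R] by [].
have mRT : measurable [set: measurableTypeR R] by [].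
have r01 : 0 < (1 : R) <= 1 by rewrite ltr01 lexx.
have piL (A : set (plane R)) : measurable A -> pi (A `*` setT) = normal2 s 1 A.
  move=> mA; rewrite -[RHS]mule1 -(probability_setT (normal2 1 1)).
  exact: product_measure1E.
have piR (A : set (plane R)) : measurable A -> pi (setT `*` A) = normal2 1 1 A.
  move=> mA; rewrite -[RHS]mul1e -(probability_setT (normal2 s 1)).
  exact: product_measure1E.
have [|A mA|m1 i1] := pow4 s (fun z => z.1.1) s01.
- exact: (measurableT_comp measurable_fst measurable_fst).
- apply: (etrans _ (etrans (piL (A `*` setT) _) (@normal2_setXT R s 1 A mA)));
    last exact: measurableX.
  by congr (pi _); apply/seteqP; split=> [z|z [[]]].
have [|A mA|m2 i2] := pow4 1 (fun z => z.1.2) r01.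
- exact: (measurableT_comp measurable_snd measurable_fst).
- apply: (etrans _ (etrans (piL (setT `*` A) _) (@normal2_setTX R s 1 A mA)));
    last exact: measurableX.
  by congr (pi _); apply/seteqP; split=> [z|z [[]]].
have [|A mA|m3 i3] := pow4 1 (fun z => z.2.1) r01.
- exact: (measurableT_comp measurable_fst measurable_snd).
- apply: (etrans _ (etrans (piR (A `*` setT) _) (@normal2_setXT R 1 1 A mA)));
    last exact: measurableX.
  by congr (pi _); apply/seteqP; split=> [z|z [_ []]].
have [|A mA|m4 i4] := pow4 1 (fun z => z.2.2) r01.
- exact: (measurableT_comp measurable_snd measurable_snd).
- apply: (etrans _ (etrans (piR (setT `*` A) _) (@normal2_setTX R 1 1 A mA)));
    last exact: measurableX.
  by congr (pi _); apply/seteqP; split=> [z|z [_ []]].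
move: (1 + 32 * 768) i1 i2 i3 i4 => K i1 i2 i3 i4.
pose F z := (z.1.1 : R) ^+ 4 + z.1.2 ^+ 4 + (z.2.1 ^+ 4 + z.2.2 ^+ 4).
have e4 (x : R) : 0 <= x ^+ 4 by rewrite exprn_even_ge0.
have m12 :
    measurable_fun setT (fun z : plane R * plane R => (z.1.1 : R) ^+ 4 + z.1.2 ^+ 4).
  exact: measurable_funD.
have m34 :
    measurable_fun setT (fun z : plane R * plane R => (z.2.1 : R) ^+ 4 + z.2.2 ^+ 4).
  exact: measurable_funD.
have mF : measurable_fun setT (F : plane R * plane R -> R) by exact: measurable_funD.
apply: (@le_trans _ _ (\int[pi]_z (16 * F z)%:E)%E).
  apply: ge0_le_integral => //.
  - by move=> z _; rewrite lee_fin powR_ge0.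
  - exact: measurable_cost.
  - by apply/measurable_EFinP; exact: measurable_funM.
  - by move=> z _; rewrite lee_fin le_cost.
under eq_integral do rewrite EFinM.
rewrite ge0_integralZl//; last 2 first.
- exact/measurable_EFinP.
- by move=> z _; rewrite lee_fin !addr_ge0.
rewrite EFinM lee_wpmul2l ?lee_fin//.
rewrite (_ : 4 * K = K + K + (K + K)); last by ring.
rewrite !EFinD; under eq_integral do rewrite EFinD.
rewrite ge0_integralD//; last 4 first.
- by move=> z _; rewrite lee_fin addr_ge0.
- exact/measurable_EFinP.
- by move=> z _; rewrite lee_fin addr_ge0.
- exact/measurable_EFinP.
apply: leeD.
  under eq_integral do rewrite EFinD.
  rewrite ge0_integralD//; last 4 first.
  - by move=> z _; rewrite lee_fin.
  - exact/measurable_EFinP.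
  - by move=> z _; rewrite lee_fin.
  - exact/measurable_EFinP.
  exact: leeD.
under eq_integral do rewrite EFinD.
rewrite ge0_integralD//; last 4 first.
- by move=> z _; rewrite lee_fin.
- exact/measurable_EFinP.
- by move=> z _; rewrite lee_fin.
- exact/measurable_EFinP.
exact: leeD.
Qed.

End transport.

(** * Limits of the transport cost and of the variance ratio *)

Lemma wasserstein_ge0 (R : realType) (p : R) (P Q : probability (plane R) R) :
  (0 <= wasserstein p P Q)%E.
Proof. by apply: le_ereal_inf_tmp => _ [pi _ <-]; exact: poweR_ge0. Qed.

Lemma cvg_pow_quarter (R : realType) (M : R) : 0 <= M ->
  (n%:R ^- 2 * M) `^ 4^-1 @[n --> \oo] --> (0 : R).
Proof.
move=> M0; apply/cvgr0Pnorm_le => e e0; near=> n.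
have n1 : 1 <= n%:R :> R by near: n; exact: nbhs_infty_ger.
(* With [n >= 1], this gives [M <= e ^ 4 * n <= e ^ 4 * n ^ 2], whose fourth root is the required
   bound. *)
have nM : M / e ^+ 4 <= n%:R by near: n; exact: nbhs_infty_ger.
have n0 : 0 < n%:R :> R by rewrite (lt_le_trans ltr01).
have eE : (e ^+ 4) `^ 4^-1 = e.
  by rewrite -powR_mulrn ?(ltW e0)// -powRrM divff// powRr1// ltW.
have nM0 : 0 <= n%:R ^- 2 * M by rewrite mulr_ge0// invr_ge0 sqr_ge0.
rewrite ger0_norm ?powR_ge0// -[leRHS]eE.
apply: ge0_ler_powR; rewrite ?nnegrE ?invr_ge0 ?exprn_ge0 ?(ltW e0)//.
rewrite mulrC ler_pdivrMr ?exprn_gt0//.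
move: nM; rewrite ler_pdivrMr ?exprn_gt0// mulrC => /le_trans; apply.
by rewrite ler_wpM2l ?exprn_ge0 ?(ltW e0)// expr2 ler_peMr ?(ltW n0).
Unshelve. all: by end_near. Qed.

Theorem mainTheorem5 (R : realType)
  (delta : nat -> {i01 R})
  (delta_def : forall n, (0 < n)%N -> (delta n)%:num = n%:R ^- 2)
  (a : nat -> R)
  (a_gt0 : forall n, (0 < n)%N -> 0 < a n)
  (a_def : forall n, (0 < n)%N -> a n ^+ 2 = (delta n)%:num ^+ (2 * n))
  (mu : probability (plane R) R)
  (mu_def : mu = normal2 1 1)
  (muhat : nat -> probability (plane R) R)
  (muhat_def : forall n, muhat n = mixture (delta n) mu (normal2 (a n) 1))
  (d : nat -> measure_display) (Omega : forall n, measurableType (d n))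
  (P : forall n, probability (Omega n) R)
  (Z : forall n, 'I_n -> {RV (P n) >-> plane R})
  (Z_iid : forall n, iid mu (@Z n))
  (dstar : nat -> measure_display)
  (Omegastar : forall n, measurableType (dstar n))
  (Pstar : forall n, probability (Omegastar n) R)
  (Zstar : forall n, 'I_n -> {RV (Pstar n) >-> plane R})
  (Zstar_iid : forall n, iid (muhat n) (@Zstar n)) :
  ((fun n => wasserstein 4 (muhat n) mu) @ \oo --> 0%E) /\
  ((fun n => 'V_(Pstar n)[ols_slope (@Zstar n)] / 'V_(P n)[ols_slope (@Z n)])%E
     @ \oo --> +oo%E).
Proof.
have d01 n : 0 <= (delta n)%:num <= 1 by apply/andP; split.
split.
  (* The uniform moment bound asks for scales at most 1; here [a n ^ 2] is a power of a number in
     [[0, 1]]. *)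
  have a_le1 n : (0 < n)%N -> a n <= 1.
    move=> n0; rewrite -(@ler_pXn2r _ 2)// ?nnegrE ?(ltW (a_gt0 _ n0))//.
    by have /andP[? ?] := d01 n; rewrite a_def// expr1n exprn_ile1.
  pose M : R := 16 * (4 * (1 + 32 * 768)).
  have M0 : 0 <= M by rewrite /M; lra.
  apply: (@squeeze_cvge _ _ _ _ (fun=> 0%E) _
      (fun n => ((n%:R ^- 2 * M) `^ 4^-1)%:E)); last 2 first.
  - exact: cvg_cst.
  - by apply: cvg_EFin; [exact: nearW|exact: cvg_pow_quarter].
  near=> n.
  have n0 : (0 < n)%N by near: n; exact: nbhs_infty_gt.
  rewrite wasserstein_ge0/= muhat_def -delta_def//.
  apply: wasserstein_mixture_le; rewrite mu_def.
  by apply: integral_cost_le; rewrite a_gt0// a_le1.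
apply/cvgeyPge => A.
have [c c0 cE] := normal2_corner_ge R.
have [K K0 VK] : exists2 K : R, 0 < K & forall n, (5 <= n)%N ->
    ('V_(P n)[ols_slope (@Z n)] <= (n%:R ^+ 2 * K)%:E)%E.
  exists (1 + 32 * 768); first lra.
  by move=> n n5; apply: variance_ols_le => //; rewrite -mu_def; exact: Z_iid.
near=> n.
have n5 : (5 <= n)%N by near: n; exact: nbhs_infty_ge.
have ratio : A <= (n%:R ^- 2 * c) ^+ n / (n%:R ^- 2) ^+ (2 * n) /
    (n%:R ^+ 2 * K).
  by near: n; exact: near_ratio_ge.
have n0 : (0 < n)%N by rewrite (leq_trans _ n5).
have [cU cL] := cE (a n) (a_gt0 n n0).
(* Only the contaminating component is kept: the mixture has at least [delta n] times its mass. *)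
have corner (B : set (plane R)) : (c%:E <= normal2 (a n) 1 B)%E ->
    ((n%:R ^- 2 * c)%:E <= muhat n B)%E.
  move=> cB; rewrite muhat_def.
  apply: le_trans (_ : ((1 - (delta n)%:num)%:E * mu B +
      (delta n)%:num%:E * normal2 (a n) 1 B <= _)%E); last by rewrite -mixtureE.
  have /andP[dn0 dn1] := d01 n.
  rewrite -[leLHS]add0e; apply: leeD.
    by apply: mule_ge0 => //; rewrite lee_fin subr_ge0.
  by rewrite -delta_def// EFinM; apply: lee_wpmul2l.
have q0 : 0 <= n%:R ^- 2 * c by rewrite mulr_ge0 ?(ltW c0)// invr_ge0 sqr_ge0.
have := variance_ols_ge (Zstar_iid n) n0 (a_gt0 n n0) q0 (corner _ cU) (corner _ cL).
rewrite a_def// delta_def// => Vge.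
have nK : 0 < n%:R ^+ 2 * K by rewrite mulr_gt0// exprn_gt0// ltr0n.
(* Inversion reverses the order on nonnegative extended reals, so the upper bound on the ordinary
   variance bounds its inverse from below. *)
have invV : (((n%:R ^+ 2 * K)^-1)%:E <= ('V_(P n)[ols_slope (@Z n)])^-1)%E.
  rewrite (_ : ((n%:R ^+ 2 * K)^-1)%:E = ((n%:R ^+ 2 * K)%:E^-1)%E); last first.
    by rewrite inver gt_eqF.
  by rewrite lee_pV2 ?inE ?VK ?variance_ge0 ?lee_fin ?ltW.
apply: (@le_trans _ _ ((n%:R ^- 2 * c) ^+ n / (n%:R ^- 2) ^+ (2 * n) /
    (n%:R ^+ 2 * K))%:E); first by rewrite lee_fin.
rewrite EFinM; apply: lee_pmul => //.
- rewrite lee_fin; apply: mulr_ge0; first exact: exprn_ge0.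
  by rewrite invr_ge0 exprn_ge0// invr_ge0 sqr_ge0.
- by rewrite lee_fin invr_ge0 ltW.
Unshelve. all: by end_near. Qed.
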